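(* Let $n\ge 1$. For every integer $g>0$, the chambers of the fine chamber decomposition of $\mathcal{D}_{g,n}$ (which does not depend on $g>0$) are in bijection with the Semi-Goldilocks linear threshold functions in $n$ variables. The chambers of the fine chamber decomposition of $\mathcal{D}_{0,n}$ are in bijection with the Goldilocks linear threshold functions in $n$ variables.
   Context: For integers $g\ge 0$, $n\ge 1$, the space of admissible weights is $\mathcal{D}_{g,n}=\{(w_1,\dots,w_n)\in\mathbb{R}^n : 0<w_j\le 1\ \forall j,\ w_1+\dots+w_n>2-2g\}$; it is the same set for all $g>0$. The fine chamber decomposition of $\mathcal{D}_{g,n}$ has as walls the hyperplanes $\{\sum_{j\in S}w_j=1\}$ for all nonempty $S\subseteq\{1,\dots,n\}$; its chambers are the connected components of the complement in $\mathcal{D}_{g,n}$ of the union of all walls. A linear threshold function (LTF) in $n$ variables is a function $f:\{0,1\}^n\to\{0,1\}$ of the form $f(\mathbf{x})=\operatorname{sgn}(\mathbf{w}\cdot\mathbf{x}-\theta)$ with $\mathbf{w}\in\mathbb{Q}^n$, $\theta\in\mathbb{Q}$, where $\operatorname{sgn}(t)=1$ if $t>0$ and $\operatorname{sgn}(t)=0$ if $t\le 0$. Any such pair $(\mathbf{w},\theta)$ is called a realization of $f$. An LTF $f$ is Semi-Goldilocks if (i) (positivity) it has a realization $(\mathbf{w},\theta)$ with $w_i>0$ for all $i$, and (ii) (smallness) it has a realization $(\mathbf{w}',\theta')$ with $w'_i\le\theta'$ for all $i$. It is Goldilocks if in addition (iii) (ampleness) it has a realization $(\mathbf{w}'',\theta'')$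 with $\sum_{i=1}^n w''_i>2\theta''$. The realizations in (i), (ii), (iii) are allowed to be different. *)

(* Defs.v *)
From HB Require Import structures.
From mathcomp Require Import all_boot all_order all_algebra.
From mathcomp Require Import all_classical all_reals all_analysis.

Set Implicit Arguments.
Unset Strict Implicit.
Unset Printing Implicit Defensive.

Import Order.TTheory GRing.Theory Num.Theory.
Import numFieldNormedType.Exports.

Local Open Scope classical_set_scope.
Local Open Scope ring_scope.

Section Chambers.
Variables (R : realType) (n : nat).

Definition admissible_weights (g : nat) : set 'rV[R]_n :=
  [set w | (forall j, 0 < w ord0 j <= 1) /\
           2 - 2 * g%:R < \sum_j w ord0 j].

Definition fine_wall (S : {set 'I_n}) : set 'rV[R]_n :=
  [set w | \sum_(j in S) w ord0 j = 1].

Definition fine_complement (D : set 'rV[R]_n) : set 'rV[R]_n :=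
  D `\` \bigcup_(S in [set S : {set 'I_n} | S != finset.set0]) fine_wall S.

Definition fine_chambers (D : set 'rV[R]_n) : set (set 'rV[R]_n) :=
  [set connected_component (fine_complement D) w | w in fine_complement D].

End Chambers.

Arguments admissible_weights : clear implicits.

Section ThresholdFunctions.
Variable n : nat.

(* {0,1} is bool, and {0,1}^n is {ffun 'I_n -> bool}. *)
Definition boolean_function := {ffun {ffun 'I_n -> bool} -> bool}.

Definition sgn01 (t : rat) : bool := 0 < t.

Definition dot01 (w : 'rV[rat]_n) (x : {ffun 'I_n -> bool}) : rat :=
  \sum_i w ord0 i * (x i)%:R.

Definition realization (f : boolean_function) (w : 'rV[rat]_n) (theta : rat) :
    Prop :=
  forall x, f x = sgn01 (dot01 w x - theta).

Definition is_LTF (f : boolean_function) : Prop :=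
  exists w theta, realization f w theta.

Definition positive_LTF (f : boolean_function) : Prop :=
  exists w theta, realization f w theta /\ forall i, 0 < w ord0 i.

Definition small_LTF (f : boolean_function) : Prop :=
  exists w theta, realization f w theta /\ forall i, w ord0 i <= theta.

Definition ample_LTF (f : boolean_function) : Prop :=
  exists w theta, realization f w theta /\ 2 * theta < \sum_i w ord0 i.

Definition semi_Goldilocks (f : boolean_function) : Prop :=
  [/\ is_LTF f, positive_LTF f & small_LTF f].

Definition Goldilocks (f : boolean_function) : Prop :=
  semi_Goldilocks f /\ ample_LTF f.

End ThresholdFunctions.

(* Main.v *)
(* A weight vector off the walls determines the threshold function
   [x |-> w . x > 1]. The weight domain is convex, so two such vectors with the
   same threshold function are joined by a segment that avoids the walls;
   conversely, on a connected set that avoids the walls each subset sum takes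
   values in an interval that omits 1. Hence chambers correspond to the
   threshold functions of admissible weights. Rational approximation from below
   shows that these are (Semi-)Goldilocks; conversely, positivity, smallness
   and ampleness can be achieved by one realization, which is then rescaled to
   have threshold 1 and moved off the walls. *)
Require Import Defs.
From HB Require Import structures.
From mathcomp Require Import all_boot all_order all_algebra.
From mathcomp Require Import all_classical all_reals all_analysis.
From mathcomp Require Import lra.

Set Implicit Arguments.
Unset Strict Implicit.
Unset Printing Implicit Defensive.

Import Order.TTheory GRing.Theory Num.Theory.
Import numFieldNormedType.Exports.

Local Open Scope classical_set_scope.
Local Open Scope ring_scope.

(** Supplies one margin for finitely many strict inequalities; entries of [s] that do not exceed
    [theta] impose nothing, so callers can list values without sorting them first. *)
Lemma exists_between_seq (K : realFieldType) (theta : K) (s : seq K) :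
  exists2 theta', theta < theta' & {in s, forall v, theta < v -> theta' < v}.
Proof.
elim: s => [|v s [t lt_t IH]]; first by exists (theta + 1); rewrite ?ltrDl.
have [v_le|v_gt] := leP v theta.
  exists t => // u; rewrite inE => /predU1P[->|]; last exact: IH.
  by rewrite ltNge v_le.
exists (Num.min t ((theta + v) / 2)); first by rewrite lt_min lt_t; lra.
move=> u; rewrite inE gt_min => /predU1P[-> _|us ltu]; last by rewrite IH.
by apply/orP; right; lra.
Qed.

Lemma lt_convex (K : realFieldType) (a x y t : K) : 0 <= t <= 1 ->
  a < x -> a < y -> a < (1 - t) * x + t * y.
Proof.
move=> /andP[]; rewrite le_eqVlt => /predU1P[<- _|t0 t1 ax ay].
  by rewrite subr0 mul1r mul0r addr0.
by nra.
Qed.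

Lemma convex_lt (K : realFieldType) (a x y t : K) : 0 <= t <= 1 ->
  x < a -> y < a -> (1 - t) * x + t * y < a.
Proof.
move=> t01; rewrite -(ltrN2 a x) -(ltrN2 a y) => xa ya.
by rewrite -ltrN2 opprD -!mulrN lt_convex.
Qed.

(** * Subset sums as linear forms evaluated at cube points *)

Section Dot.
Variable n : nat.
Implicit Types x : {ffun 'I_n -> bool}.

Definition dot (K : pzSemiRingType) (w : 'rV[K]_n) x : K :=
  \sum_i w ord0 i * (x i)%:R.

Definition unit_point (i : 'I_n) : {ffun 'I_n -> bool} := [ffun j => j == i].

Lemma dot_unit_point (K : pzSemiRingType) (w : 'rV[K]_n) i :
  dot w (unit_point i) = w ord0 i.
Proof.
rewrite /dot (bigD1 i)//= big1 ?ffunE ?eqxx ?addr0 ?mulr1// => j /negbTE ji.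
by rewrite ffunE ji mulr0.
Qed.

Lemma dotD (K : pzSemiRingType) (v w : 'rV[K]_n) x :
  dot (v + w) x = dot v x + dot w x.
Proof. by rewrite -big_split; apply: eq_bigr => i _; rewrite mxE mulrDl. Qed.

Lemma dotZ (K : pzSemiRingType) (a : K) (w : 'rV[K]_n) x :
  dot (a *: w) x = a * dot w x.
Proof. by rewrite /dot mulr_sumr; apply: eq_bigr => i _; rewrite mxE mulrA. Qed.

Lemma dot_set (K : pzSemiRingType) (w : 'rV[K]_n) (S : {set 'I_n}) :
  \sum_(j in S) w ord0 j = dot w [ffun j => j \in S].
Proof.
rewrite big_mkcond; apply: eq_bigr => i _; rewrite ffunE.
by case: (i \in S); rewrite ?mulr1 ?mulr0.
Qed.

Lemma dot_ratr (K : numFieldType) (q : 'rV[rat]_n) x :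
  dot (map_mx ratr q : 'rV[K]_n) x = ratr (dot q x).
Proof.
by rewrite rmorph_sum; apply: eq_bigr => i _; rewrite mxE rmorphM rmorph_nat.
Qed.

Lemma dot_continuous (R : realType) x : continuous (fun w : 'rV[R]_n => dot w x).
Proof.
apply: continuous_big => [|i _]; first exact: add_continuous.
by move=> w; apply: (cvgMr_tmp (@coord_continuous R _ _ ord0 i w)).
Qed.

End Dot.

(** * Chambers and threshold functions of real weights *)

Section Chambers.
Variables (R : realType) (n : nat).
Implicit Types (w : 'rV[R]_n) (D : set 'rV[R]_n).

Definition threshold w : boolean_function n := [ffun x => 1 < dot w x].

Definition weight_convex D := forall v w (t : R), D v -> D w -> 0 <= t <= 1 ->
  D ((1 - t) *: v + t *: w).

(** Cube points are indicator functions of subsets. The empty subset may be included, since its sum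
    0 is never 1. *)
Lemma fine_complementP D w :
  fine_complement D w <-> D w /\ forall x, dot w x != 1.
Proof.
split=> [[Dw Nw]|[Dw Nw]]; split=> //.
  move=> x; apply/eqP => wx; apply: Nw.
  have xE : [ffun j => j \in finset x] = x.
    by apply/ffunP => j; rewrite !ffunE inE.
  exists (finset x); last by rewrite /fine_wall /= dot_set xE.
  apply/eqP => x0; move: wx; rewrite -xE x0 -dot_set big_set0 => /eqP.
  by rewrite eq_sym oner_eq0.
by move=> [S _]; rewrite /fine_wall/= dot_set => /eqP; apply/negP.
Qed.

Lemma segment_continuous (v w : 'rV[R]_n) :
  continuous (fun t : R => (1 - t) *: v + t *: w).
Proof.
move=> t; apply: cvgD; apply: cvgZr_tmp => //.
by apply: cvgB => //; exact: cvg_cst.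
Qed.

Lemma same_threshold_component D v w : weight_convex D ->
  fine_complement D v -> fine_complement D w -> threshold v = threshold w ->
  connected_component (fine_complement D) v =
  connected_component (fine_complement D) w.
Proof.
move=> cD /fine_complementP[Dv Nv] /fine_complementP[Dw Nw] vw.
apply: same_connected_component.
pose seg := [set (1 - t) *: v + t *: w | t in `[0, 1] : set R].
apply: (@connected_component_max _ _ seg).
- by exists 0; rewrite /= ?in_itv/= ?lexx ?ler01// subr0 scale1r scale0r addr0.
- move=> _ [t + <-]; rewrite /= in_itv/= => t01; apply/fine_complementP.
  split=> [|x]; first exact: cD.
  rewrite dotD !dotZ; move/ffunP/(_ x): vw; rewrite !ffunE.
  have := Nv x; have := Nw x.
  (* Equal threshold functions put [dot v x] and [dot w x] on the same side of 1, and the convex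
     combination stays there. *)
  case: (ltgtP (dot w x) 1) => // wx _; case: (ltgtP (dot v x) 1) => // vx _ _.
    by rewrite lt_eqF// convex_lt.
  by rewrite gt_eqF// lt_convex.
- refine (connected_continuous_connected (@segment_connected R 0 1) _).
  by apply: continuous_subspaceT => t; exact: segment_continuous.
- exists 1; rewrite /= ?in_itv/= ?lexx ?ler01//.
  by rewrite subrr scale0r scale1r add0r.
Qed.

Lemma component_threshold D v w :
  connected_component (fine_complement D) v w -> threshold v = threshold w.
Proof.
move=> [A [Av AD cA] Aw]; apply/ffunP => x; rewrite !ffunE.
have /connected_intervalP itvA : connected [set dot u x | u in A].
  apply: connected_continuous_connected => //.
  by apply: continuous_subspaceT => u; exact: dot_continuous.
have N1 : ~ [set dot u x | u in A] 1.
  by move=> [u /AD/fine_complementP[_ /(_ x)/eqP]].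
have im u : A u -> [set dot u x | u in A] (dot u x) by move=> Au; exists u.
case: (ltP 1 (dot v x)) => vx; case: (ltP 1 (dot w x)) => wx //; case: N1.
  by apply: (itvA _ _ (im _ Aw) (im _ Av)); rewrite wx ltW.
by apply: (itvA _ _ (im _ Av) (im _ Aw)); rewrite vx ltW.
Qed.

(** Reduces both bijections to identifying the image of [threshold]. *)
Lemma chambers_bij_threshold D : weight_convex D ->
  exists F, set_bij (fine_chambers D) (threshold @` fine_complement D) F.
Proof.
(* [xget 0 C] picks a point of [C]; the default 0 is never reached on a chamber, which is
   nonempty. *)
move=> cD; exists (fun C => threshold (xget 0 C)).
have FE w : fine_complement D w ->
    threshold (xget 0 (connected_component (fine_complement D) w)) = threshold w.
  move=> Dw; apply/esym/(@component_threshold D).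
  by apply: xgetPex; exists w; exact: connected_component_refl.
split.
- by move=> _ [w Dw <-]; exists w => //; rewrite FE.
- move=> C C'; rewrite !inE => -[v Dv <-] [w Dw <-]; rewrite !FE//.
  exact: same_threshold_component.
- by move=> _ [w Dw <-]; exists (connected_component (fine_complement D) w);
    [exists w | rewrite FE].
Qed.

Lemma admissible_weights_convex g : weight_convex (admissible_weights R n g).
Proof.
move=> v w t [v01 vs] [w01 ws] /andP[t0 t1]; split=> [j|].
  rewrite !mxE; have /andP[v0 v1] := v01 j; have /andP[w0 w1] := w01 j.
  by rewrite lt_convex ?t0//=; nra.
under eq_bigr do rewrite !mxE.
by rewrite big_split/= -!mulr_sumr lt_convex ?t0.
Qed.

(** For positive genus the bound [2 - 2 * g] is at most 0, while a nonempty sum of positive weights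
    is positive. *)
Lemma admissible_weights_pos g : (1 <= n)%N -> (0 < g)%N ->
  admissible_weights R n g = [set w | forall j, 0 < w ord0 j <= 1].
Proof.
move=> n1 g0; apply/seteqP; split=> w /= => [[]//|w01]; split=> //.
have [j0] : exists j0 : 'I_n, True by exists (Ordinal n1).
move=> _; apply: (@le_lt_trans _ _ 0).
  by have : (1 : R) <= g%:R by [rewrite ler1n]; lra.
rewrite (bigD1 j0)//=; apply: ltr_wpDr; last by case/andP: (w01 j0).
by apply: sumr_ge0 => j _; case/andP: (w01 j) => /ltW.
Qed.

(* Approximating each weight from below keeps every subset sum that is less
   than 1 less than 1, so only strict lower bounds have to be preserved. *)
Lemma threshold_rational w : (1 <= n)%N -> (forall j, 0 < w ord0 j <= 1) ->
  (forall x, dot w x != 1) ->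
  exists q : 'rV[rat]_n,
    [/\ forall j, 0 < q ord0 j <= 1, realization (threshold w) q 1
      & 2 < \sum_j w ord0 j -> 2 < \sum_j q ord0 j].
Proof.
move=> n1 w01 Nw; have n0 : 0 < n%:R :> R by rewrite ltr0n.
(* The margin [d] is below every weight, and [d * n] is below each positive excess of a subset sum
   over 1 or of the total over 2. Lowering all [n] weights by less than [d] thus preserves these
   bounds. *)
have [d d0 dP] := exists_between_seq 0
  ([seq w ord0 j | j : 'I_n] ++
   (\sum_j w ord0 j - 2) / n%:R ::
   [seq (dot w x - 1) / n%:R | x : {ffun 'I_n -> bool}]).
have dw j : d < w ord0 j.
  apply: dP; last by case/andP: (w01 j).
  by rewrite mem_cat fintype.image_f.
have ds : 2 < \sum_j w ord0 j -> d * n%:R < \sum_j w ord0 j - 2.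
  move=> s2; rewrite -ltr_pdivlMr//; apply: dP.
    by rewrite mem_cat inE eqxx orbT.
  by rewrite divr_gt0// subr_gt0.
have dx x : 1 < dot w x -> d * n%:R < dot w x - 1.
  move=> x1; rewrite -ltr_pdivlMr//; apply: dP.
    by rewrite mem_cat inE fintype.image_f ?orbT.
  by rewrite divr_gt0// subr_gt0.
have /choice[q qP] (j : 'I_n) :
    exists q, ratr q \in `](w ord0 j - d), (w ord0 j)[.
  by apply: rat_in_itvoo; rewrite ltrBlDr ltrDl.
have {qP} qP j : w ord0 j - d < ratr (q j) < w ord0 j.
  by have := qP j; rewrite in_itv.
pose Q : 'rV[rat]_n := \row_j q j.
have QE j : ratr (Q ord0 j) = ratr (q j) :> R by rewrite mxE.
have dotQ_le x : ratr (dot Q x) <= dot w x.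
  rewrite -dot_ratr; apply: ler_sum => j _; rewrite mxE QE.
  by apply: ler_wpM2r; [exact: ler0n | case/andP: (qP j) => _ /ltW].
have dotQ_ge x : dot w x - d * n%:R <= ratr (dot Q x).
  rewrite -dot_ratr mulr_natr -{2}(card_ord n) -sumr_const -sumrB.
  apply: ler_sum => j _; rewrite mxE QE.
  by have /andP[/ltW] := qP j; case: (x j) => /=; rewrite ?mulr1 ?mulr0//; lra.
exists Q; split.
- move=> j; rewrite -(ltr_rat R) -(ler_rat R) rmorph0 rmorph1 QE.
  have /andP[w0 w1] := w01 j; have /andP[q0 q1] := qP j; have := dw j.
  by move=> dwj; apply/andP; split; lra.
- move=> x; rewrite ffunE /sgn01 subr_gt0 -[dot01 _ _]/(dot Q x).
  rewrite -(ltr_rat R) rmorph1.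
  have := Nw x; case: ltgtP => // wx _; apply/esym.
    by have := dx _ wx; have := dotQ_ge x; lra.
  by apply/negbTE; rewrite -leNgt (le_trans (dotQ_le x))// ltW.
- move=> /ds s2; rewrite -(ltr_rat R) rmorph_nat.
  (* The total weight is the value at the all-ones point. *)
  have := dotQ_ge [ffun=> true]; rewrite -dot_ratr /dot.
  under eq_bigr do rewrite ffunE mulr1; rewrite /dot.
  under [X in _ <= X]eq_bigr do rewrite ffunE mulr1 mxE.
  by rewrite rmorph_sum; lra.
Qed.

End Chambers.

(** * Combining realizations and normalizing the threshold to 1 *)

Section NormalizedRealizations.
Variable n : nat.
Implicit Types (f : boolean_function n) (w : 'rV[rat]_n) (theta : rat).

Lemma realizationP f w theta :
  realization f w theta <-> forall x, f x = (theta < dot w x).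
Proof. by split=> fw x; have := fw x; rewrite /sgn01 subr_gt0. Qed.

Lemma positive_monotone f w theta : realization f w theta ->
  (forall i, 0 < w ord0 i) ->
  forall x y : {ffun 'I_n -> bool}, (forall i, x i -> y i) -> f x -> f y.
Proof.
move=> /realizationP fw w0 x y xy; rewrite !fw => /lt_le_trans; apply.
apply: ler_sum => i _; apply: ler_wpM2l; first exact: ltW.
by have := xy i; case: (x i) => [->|_]; rewrite ?ler0n.
Qed.

(** Expresses smallness through the values of [f] alone, so that it carries over to every other
    realization. *)
Lemma small_unit_point f i : small_LTF f -> f (unit_point i) = false.
Proof.
move=> [w [theta [/realizationP -> wP]]].
by rewrite dot_unit_point ltNge wP.
Qed.

(* A positive LTF is monotone, so it does not depend on a variable that has
   negative weight in some realization; hence in an ample realization the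
   negative weights can be replaced by 0, after which adding a small multiple
   of a positive realization makes all weights positive. *)
Lemma ample_positive f : positive_LTF f -> ample_LTF f ->
  exists w theta, [/\ realization f w theta, forall i, 0 < w ord0 i
                    & 2 * theta < \sum_i w ord0 i].
Proof.
move=> [u [eta [fu u0]]] [v [theta [fv vs]]].
have mono := positive_monotone fu u0.
move/realizationP: fu => fu; move/realizationP: fv => fv.
pose p : 'rV[rat]_n := \row_i Num.max 0 (v ord0 i).
have p0 i : 0 <= p ord0 i by rewrite mxE le_max lexx.
have vp i : v ord0 i <= p ord0 i by rewrite mxE le_max lexx orbT.
have fp x : f x = (theta < dot p x).
  (* Switching off the variables of nonpositive weight keeps the value of [f]: it cannot rise by
     monotonicity, and cannot fall because [dot v x <= dot v y]. *)
  pose y := [ffun i => x i && (0 < v ord0 i)].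
  have py : dot p x = dot v y.
    apply: eq_bigr => i _; rewrite mxE ffunE.
    case: (x i); rewrite ?mulr0//=.
    by case: ltP; rewrite ?mulr1 ?mulr0// mul0r.
  rewrite py -fv; apply/idP/idP; last first.
    by apply: mono => i; rewrite ffunE => /andP[].
  rewrite !fv => /lt_le_trans; apply; rewrite -py.
  by apply: ler_sum => i _; apply: ler_wpM2r; rewrite ?ler0n.
have ps : 2 * theta < \sum_i p ord0 i.
  by apply: lt_le_trans vs _; apply: ler_sum => i _; exact: vp.
(* This bound on [e] is exactly ampleness of the realization [p + e *: u] with threshold
   [theta + e * eta]. *)
have [e e0 eP] : exists2 e, 0 < e &
    e * (2 * eta - \sum_i u ord0 i) < \sum_i p ord0 i - 2 * theta.
  set a := 2 * eta - _; set c := _ - _.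
  have c0 : 0 < c by rewrite subr_gt0.
  have a1 : 0 < 1 + `|a| by rewrite ltr_pwDl.
  exists (c / (1 + `|a|)); first exact: divr_gt0.
  rewrite mulrAC ltr_pdivrMr// ltr_pM2l//.
  by rewrite (le_lt_trans (ler_norm a))// ltrDr.
exists (p + e *: u), (theta + e * eta); split.
(* Since [p] and [u] both realize [f], their values at [x] lie on the same side of their thresholds,
   and so does the positive combination. *)
- apply/realizationP => x; rewrite dotD dotZ.
  have := fp x; rewrite fu; case: ltP => ux; case: ltP => // px _; apply/esym.
    by nra.
  by apply/negbTE; rewrite -leNgt; nra.
- by move=> i; rewrite !mxE ltr_wpDl// ?mulr_gt0//
    le_max lexx.
- under eq_bigr do rewrite mxE [X in _ + X]mxE.
  by rewrite big_split/= -mulr_sumr; lra.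
Qed.

(* Raising [theta] slightly moves all values off the threshold; rescaling then
   makes the threshold 1. *)
Lemma normalized_realization f w theta : (1 <= n)%N -> realization f w theta ->
  (forall i, 0 < w ord0 i) -> (forall i, f (unit_point i) = false) ->
  exists u : 'rV[rat]_n, [/\ forall i, 0 < u ord0 i <= 1, forall x, dot u x != 1,
    realization f u 1 & 2 * theta < \sum_i w ord0 i -> 2 < \sum_i u ord0 i].
Proof.
move=> n1 /realizationP fw w0 f0.
have w_le i : w ord0 i <= theta.
  by have := f0 i; rewrite fw dot_unit_point => /negbT; rewrite -leNgt.
(* No value of [dot w] lies above [theta] and at or below [t]. Half the total weight is listed too,
   so that ampleness survives the change of threshold. *)
have [t lt_t tP] := exists_between_seq theta
  ((\sum_i w ord0 i) / 2 :: [seq dot w x | x : {ffun 'I_n -> bool}]).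
(* As [n] is at least 1, some positive weight is bounded by [theta]; division by [t] is then
   legitimate. *)
have t0 : 0 < t.
  apply: lt_trans lt_t; apply: lt_le_trans (w_le (Ordinal n1)); exact: w0.
have tx x : theta < dot w x -> t < dot w x.
  by apply: tP; rewrite inE fintype.image_f ?orbT.
exists (t^-1 *: w); split.
- move=> i; rewrite mxE mulr_gt0 ?invr_gt0//= mulrC ler_pdivrMr// mul1r.
  by rewrite (le_trans (w_le i)) ?ltW.
- move=> x; rewrite dotZ mulrC; apply/eqP => /divr1_eq xt.
  have [/le_lt_trans/(_ lt_t)|/tx] := leP (dot w x) theta;
    by rewrite xt ltxx.
- apply/realizationP => x; rewrite fw dotZ mulrC ltr_pdivlMr// mul1r.
  apply/idP/idP; [exact: tx | exact: lt_trans].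
- under [X in _ -> _ < X]eq_bigr do rewrite mxE.
  rewrite -mulr_sumr [_^-1 * _]mulrC ltr_pdivlMr// => s2.
  have : t < (\sum_i w ord0 i) / 2 by apply: tP; rewrite ?inE ?eqxx//; lra.
  by lra.
Qed.

Lemma threshold_ratr (R : realType) f u : realization f u 1 ->
  threshold (map_mx ratr u : 'rV[R]_n) = f.
Proof.
move=> /realizationP fu; apply/ffunP => x.
by rewrite ffunE dot_ratr fu -(ltr_rat R) rmorph1.
Qed.

End NormalizedRealizations.

(** * The image of [threshold] on admissible weights *)

Section ThresholdImage.
Variables (R : realType) (n : nat).

(** In genus 0 the lower bound on the total weight is 2, which is ampleness for threshold 1; in
    positive genus the bound holds automatically. *)
Lemma normalized_fine_complement g (u : 'rV[rat]_n) : (1 <= n)%N ->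
  (forall i, 0 < u ord0 i <= 1) -> (forall x, dot u x != 1) ->
  (0 < g)%N || (2 < \sum_i u ord0 i) ->
  fine_complement (admissible_weights R n g) (map_mx ratr u).
Proof.
move=> n_ge1 u01 Nu gu; apply/fine_complementP; split; last first.
  by move=> x; rewrite dot_ratr -(rmorph1 (@ratr R)) (inj_eq (fmorph_inj _)).
have ru01 j : 0 < (map_mx ratr u : 'rV[R]_n) ord0 j <= 1.
  by rewrite mxE -(rmorph1 (@ratr R)) ltr0q ler_rat.
case: (posnP g) gu => [-> /= u2|g0 _]; last by rewrite admissible_weights_pos.
split=> //; rewrite mulr0 subr0; under eq_bigr do rewrite mxE.
by rewrite -rmorph_sum -(ltr_rat R) rmorph_nat in u2 *.
Qed.

Lemma semi_Goldilocks_threshold g : (1 <= n)%N -> (0 < g)%N ->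
  [set f | semi_Goldilocks f] =
  @threshold R n @` fine_complement (admissible_weights R n g).
Proof.
move=> n_ge1 g0; apply/seteqP; split=> [f /= [_ [w [theta [fw w0]]] sf]|].
  have [u [u01 Nu fu _]] := normalized_realization n_ge1 fw w0
    (fun i => small_unit_point i sf).
  exists (map_mx ratr u); last exact: threshold_ratr.
  by apply: normalized_fine_complement; rewrite ?g0.
move=> _ [w /fine_complementP[[w01 _] Nw] <-] /=.
have [q [q01 fq _]] := threshold_rational n_ge1 w01 Nw.
by split; exists q, 1; rewrite //; split=> // i; case/andP: (q01 i).
Qed.

Lemma Goldilocks_threshold : (1 <= n)%N ->
  [set f | Goldilocks f] =
  @threshold R n @` fine_complement (admissible_weights R n 0).
Proof.
move=> n_ge1; apply/seteqP; split=> [f /= [[_ pf sf] af]|].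
  have [w [theta [fw w0 ws]]] := ample_positive pf af.
  have [u [u01 Nu fu /(_ ws) us]] := normalized_realization n_ge1 fw w0
    (fun i => small_unit_point i sf).
  exists (map_mx ratr u); last exact: threshold_ratr.
  by apply: normalized_fine_complement; rewrite ?us.
move=> _ [w /fine_complementP[[w01 ws] Nw] <-] /=.
rewrite mulr0 subr0 in ws.
have [q [q01 fq /(_ ws) qs]] := threshold_rational n_ge1 w01 Nw.
split; last by exists q, 1; rewrite mulr1.
by split; exists q, 1; rewrite //; split=> // i; case/andP: (q01 i).
Qed.

End ThresholdImage.

Theorem theorem1p2 (R : realType) (n : nat) (n_ge1 : (1 <= n)%N) :
  [/\ (forall g g' : nat, (0 < g)%N -> (0 < g')%N ->
         admissible_weights R n g = admissible_weights R n g'),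
      (forall g : nat, (0 < g)%N ->
         exists F : set 'rV[R]_n -> boolean_function n,
           set_bij (fine_chambers (admissible_weights R n g))
                   [set f | semi_Goldilocks f] F)
    & exists F : set 'rV[R]_n -> boolean_function n,
        set_bij (fine_chambers (admissible_weights R n 0))
                [set f | Goldilocks f] F].
Proof.
split.
- by move=> g g' g0 g'0; rewrite !admissible_weights_pos.
- move=> g g0; rewrite (semi_Goldilocks_threshold R n_ge1 g0).
  exact/chambers_bij_threshold/admissible_weights_convex.
- rewrite (Goldilocks_threshold R n_ge1).
  exact/chambers_bij_threshold/admissible_weights_convex.
Qed.
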